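(* Let $\mathcal{E}$ be a nilpotent evolution algebra of type $[1,1,1,1,1]$ over an algebraically closed field $\mathbb{F}$ of characteristic not two. Then $\mathcal{E}$ is isomorphic to one of the following evolution algebras, given by the squares of the elements of a natural basis $\{e_1,\ldots,e_5\}$ (products $e_je_k$ with $j\neq k$ are $0$), where in all cases $e_3^2=e_4$, $e_4^2=e_5$, $e_5^2=0$, and: - (1) $e_1^2=e_2$, $e_2^2=e_3$; - (2) $e_1^2=e_2+e_4$, $e_2^2=e_3$; - (3) $e_1^2=e_2+e_3+\alpha e_4$, $e_2^2=e_3$, with $\alpha\in\mathbb{F}$; - (4) $e_1^2=e_2+\alpha e_3+\beta e_4$, $e_2^2=e_3+e_4$, with $\alpha,\beta\in\mathbb{F}$. Algebras in different families among (1)–(4) are not isomorphic. Two algebras in family (3) with different values of the parameter are not isomorphic. Two algebras in family (4) with parameters $(\alpha,\beta)$ and $(\alpha',\beta')$ are isomorphic if and only if $(\alpha',\beta')=(\alpha,\beta)$ or $(\alpha',\beta')=(-\alpha,-\beta)$.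
   Context: An evolution algebra (finite-dimensional here) is an algebra $\mathcal{E}$ over $\mathbb{F}$ with a basis $\{e_1,\ldots,e_n\}$ (a natural basis) such that $e_je_k=0$ for $j\neq k$; it is automatically commutative, and need not be associative. For an algebra $\mathcal{A}$, $\mathrm{ann}(\mathcal{A})=\{x\in\mathcal{A}: x\mathcal{A}=\mathcal{A}x=0\}$, $\mathrm{ann}^0(\mathcal{A})=0$, and $\mathrm{ann}^j(\mathcal{A})$ is defined by $\mathrm{ann}^j(\mathcal{A})/\mathrm{ann}^{j-1}(\mathcal{A})=\mathrm{ann}(\mathcal{A}/\mathrm{ann}^{j-1}(\mathcal{A}))$. With $\mathcal{A}^1=\mathcal{A}$ and $\mathcal{A}^{k+1}=\sum_{j=1}^k\mathcal{A}^j\mathcal{A}^{k+1-j}$, $\mathcal{A}$ is nilpotent if $\mathcal{A}^m=0$ for some $m$, equivalently $\mathrm{ann}^r(\mathcal{A})=\mathcal{A}$ for some $r$. The type of a finite-dimensional nilpotent algebra $\mathcal{A}$ is the sequence $[n_1,\ldots,n_r]$, where $r$ is the least natural number with $\mathrm{ann}^r(\mathcal{A})=\mathcal{A}$ and $n_j=\dim\mathrm{ann}^j(\mathcal{A})-\dim\mathrm{ann}^{j-1}(\mathcal{A})$. *)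

(* Defs.v *)
From HB Require Import structures.
From mathcomp Require Import all_boot all_order all_algebra.

Set Implicit Arguments.
Unset Strict Implicit.
Unset Printing Implicit Defensive.

Import GRing.Theory.
Local Open Scope ring_scope.

(* A finite-dimensional, not necessarily associative algebra over F is a
   vectType A together with its product mul : {bilinear A -> A -> A}. *)

Section Algebra.
Variables (F : fieldType) (A : vectType F).
Implicit Types (mul : {bilinear A -> A -> A}) (U V W : {vspace A}).

Definition natural_basis mul n (e : n.-tuple A) : Prop :=
  basis_of fullv e /\
  forall j k : 'I_n, j != k -> mul (tnth e j) (tnth e k) = 0.

Definition evolution_algebra mul : Prop :=
  exists n : nat, exists e : n.-tuple A, natural_basis mul e.

Definition mulv mul U V : {vspace A} :=
  <<allpairs mul (vbasis U) (vbasis V)>>%VS.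

Lemma mulvP mul U V W :
  reflect {in U & V, forall u v, mul u v \in W} (mulv mul U V <= W)%VS.
Proof.
apply: (iffP idP) => [sW u v Uu Vv | sW]; last first.
  apply/span_subvP=> _ /allpairsP[[u v] /= [Uu Vv ->]].
  by apply: sW; apply: vbasis_mem.
apply: (subvP sW); rewrite (coord_vbasis Uu) (coord_vbasis Vv).
rewrite linear_sumlz; apply: memv_suml => i _.
rewrite linear_sumr; apply: memv_suml => j _.
rewrite linearZl_LR linearZr_LR !memvZ // memv_span //.
by apply/allpairsP; exists ((vbasis U)`_i, (vbasis V)`_j); rewrite !memt_nth.
Qed.

(* A^{k+1} from s = [:: A^1; ...; A^k]. *)
Definition next_power mul (s : seq {vspace A}) : {vspace A} :=
  if s is [::] then fullv
  else (\sum_(0 <= j < size s)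
          mulv mul (nth fullv s j) (nth fullv s ((size s).-1 - j)))%VS.

(* [:: A^1; ...; A^k] *)
Fixpoint alg_powers mul (k : nat) : seq {vspace A} :=
  if k is m.+1 then
    rcons (alg_powers mul m) (next_power mul (alg_powers mul m))
  else [::].

(* The junk value at k = 0 is the whole algebra. *)
Definition alg_pow mul (k : nat) : {vspace A} :=
  nth fullv (alg_powers mul k) k.-1.

Lemma size_alg_powers mul k : size (alg_powers mul k) = k.
Proof. by elim: k => //= k IHk; rewrite size_rcons IHk. Qed.

Lemma nth_alg_powers mul k j : (j < k)%N ->
  nth fullv (alg_powers mul k) j = alg_pow mul j.+1.
Proof.
elim: k => // k IHk; rewrite ltnS leq_eqVlt => /predU1P[-> // | ltjk].
by rewrite /= nth_rcons size_alg_powers ltjk IHk.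
Qed.

Lemma alg_pow1 mul : alg_pow mul 1 = fullv.
Proof. by []. Qed.

Lemma alg_powS mul k : (0 < k)%N ->
  alg_pow mul k.+1 =
    (\sum_(1 <= j < k.+1) mulv mul (alg_pow mul j) (alg_pow mul (k.+1 - j)))%VS.
Proof.
move=> k_gt0; rewrite big_add1 {1}/alg_pow [alg_powers _ _]/=.
rewrite nth_rcons size_alg_powers ltnn eqxx.
have ->: next_power mul (alg_powers mul k) =
    (\sum_(0 <= j < k) mulv mul (nth fullv (alg_powers mul k) j)
       (nth fullv (alg_powers mul k) (k.-1 - j)))%VS.
  rewrite /next_power; case Es: (alg_powers mul k) => [|V s].
    by move: k_gt0; rewrite -(size_alg_powers mul k) Es.
  by rewrite -Es size_alg_powers.
apply: eq_big_nat => j /andP[_ ltjk].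
by rewrite !nth_alg_powers ?subSS -?predn_sub ?prednK ?subn_gt0 ?leq_subr //
           ltn_predL subn_gt0.
Qed.

Definition nilpotent_algebra mul : Prop :=
  exists m : nat, alg_pow mul m = 0%VS.

(* By bilinearity it is enough to annihilate a basis; see mem_ann. *)
Definition ann mul : {vspace A} :=
  (\bigcap_(i < \dim {: A})
     (lker (linfun (mul (vbasis {: A})`_i)) :&:
      lker (linfun (applyr mul (vbasis {: A})`_i))))%VS.

Lemma mem_ann mul x : x \in ann mul <-> forall y, mul x y = 0 /\ mul y x = 0.
Proof.
rewrite memvE; split=> [/subv_bigcapP xP y | xP].
  rewrite (coord_vbasis (memvf y)) linear_sumr linear_sumlz.
  by split; apply: big1 => i _; move: (xP i isT);
     rewrite -memvE memv_cap !memv_ker !lfunE /= ?linearZr_LR ?linearZl_LR;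
     case/andP=> /eqP l0 /eqP r0; rewrite ?l0 ?r0 scaler0.
apply/subv_bigcapP => i _; rewrite -memvE memv_cap !memv_ker !lfunE /=.
by have [-> ->] := xP (vbasis {: A})`_i; rewrite eqxx.
Qed.

(* The quotient A / U, realised on a complement of U; quo_proj is the canonical
   projection.  Note that vsproj U^C alone need not vanish on U. *)
Local Notation quo U := (subvs_of (U^C)%VS).

Definition quo_proj U (x : A) : quo U := vsproj (U^C)%VS (x - projv U x).

Fact quo_proj_is_linear U : linear (@quo_proj U).
Proof.
move=> a x y; rewrite /quo_proj -linearP /=; congr (vsproj _ _).
by rewrite linearP /= scalerBr opprD addrACA.
Qed.
HB.instance Definition _ U :=
  GRing.isLinear.Build F A (quo U) _ (@quo_proj U) (@quo_proj_is_linear U).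

Lemma quo_proj_eq0 U x : (quo_proj U x == 0) = (x \in U).
Proof.
rewrite /quo_proj; apply/eqP/idP => [/(congr1 vsval) | Ux]; last first.
  by rewrite projv_id // subrr linear0.
rewrite vsprojK ?memv_projC //= => /eqP; rewrite subr_eq0 => /eqP ->.
exact: memv_proj.
Qed.

Lemma quo_projK U (a : quo U) : quo_proj U (vsval a) = a.
Proof.
rewrite /quo_proj; suff ->: projv U (vsval a) = 0 by rewrite subr0 vsvalK.
by apply/eqP; rewrite -memv_ker lker_proj subvsP.
Qed.

(* Meaningful when U is an ideal; see quo_mulE. *)
Definition quo_mul mul U (a b : quo U) : quo U :=
  quo_proj U (mul (vsval a) (vsval b)).

Fact quo_mul_is_bilinear mul U :
  bilinear_for *:%R *:%R (@quo_mul mul U : quo U -> quo U -> quo U).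
Proof.
split=> [b | a] k x y; rewrite /quo_mul /=.
  by rewrite linearPl linearP.
by rewrite linearPr linearP.
Qed.
HB.instance Definition _ mul U :=
  bilinear_isBilinear.Build F (quo U) (quo U) (quo U) *:%R *:%R
    (@quo_mul mul U) (@quo_mul_is_bilinear mul U).

Definition ideal mul U : Prop :=
  forall x y, x \in U -> mul x y \in U /\ mul y x \in U.

Lemma quo_mulE mul U x y : ideal mul U ->
  quo_mul mul (quo_proj U x) (quo_proj U y) = quo_proj U (mul x y).
Proof.
move=> idU.
have quoP z : exists2 u, u \in U & vsval (quo_proj U z) = z - u.
  exists (projv U z); first exact: memv_proj.
  by rewrite /quo_proj vsprojK ?memv_projC.
have [[u Uu xE] [v Vv yE]] := (quoP x, quoP y).
rewrite /quo_mul xE yE; apply/eqP; rewrite -subr_eq0 -linearB /= quo_proj_eq0.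
have -> : mul (x - u) (y - v) - mul x y = - (mul u (y - v) + mul x v).
  rewrite linearBl [mul x (y - v)]linearBr addrAC [_ - _ - mul x y]addrAC.
  by rewrite subrr add0r opprD addrC.
by rewrite rpredN rpredD; [| have [] := idU u (y - v) Uu
                           | have [] := idU v x Vv].
Qed.

End Algebra.

Arguments quo_proj {F A} U x.

Section AnnihilatorSeries.
Variables (F : fieldType) (A : vectType F).
Implicit Types (mul : {bilinear A -> A -> A}).

Fixpoint ann_series mul (j : nat) : {vspace A} :=
  if j is i.+1 then
    let U := ann_series mul i in
    (linfun (quo_proj U) @^-1: ann (quo_mul mul (U := U)))%VS
  else 0%VS.

Definition has_type mul (s : seq nat) : Prop :=
  [/\ ann_series mul (size s) = fullv,
      forall k, ann_series mul k = fullv -> (size s <= k)%N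
    & forall j, (j < size s)%N ->
        nth 0%N s j = (\dim (ann_series mul j.+1) - \dim (ann_series mul j))%N].

Lemma mem_preim_quo_proj (U : {vspace A}) (W : {vspace subvs_of (U^C)%VS}) x :
  (x \in linfun (quo_proj U) @^-1: W)%VS = (quo_proj U x \in W).
Proof. by rewrite -memv_preim lfunE. Qed.

Lemma ann_series_ideal mul j : ideal mul (ann_series mul j).
Proof.
elim: j => [x y | j IHj x y] /=.
  by rewrite memv0 => /eqP->; rewrite linear0l linear0r mem0v.
have sub z : z \in ann_series mul j ->
    (z \in linfun (quo_proj (ann_series mul j)) @^-1:
             ann (quo_mul mul (U := ann_series mul j)))%VS.
  rewrite -quo_proj_eq0 => /eqP z0.
  by rewrite mem_preim_quo_proj z0 mem0v.
rewrite mem_preim_quo_proj => /mem_ann/(_ (quo_proj _ y)).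
rewrite /= !quo_mulE // => -[/eqP + /eqP].
by rewrite !quo_proj_eq0; split; apply: sub.
Qed.

Lemma mem_ann_seriesS mul j x :
  x \in ann_series mul j.+1 <->
  forall y, mul x y \in ann_series mul j /\ mul y x \in ann_series mul j.
Proof.
have idj := @ann_series_ideal mul j.
rewrite /= mem_preim_quo_proj; split=> [/mem_ann xP y | xP].
  have := xP (quo_proj _ y).
  by rewrite /= !quo_mulE // => -[/eqP + /eqP]; rewrite !quo_proj_eq0.
apply/mem_ann => b; rewrite -(quo_projK b) /= !quo_mulE //.
by split; apply/eqP; rewrite quo_proj_eq0; have [] := xP (vsval b).
Qed.

End AnnihilatorSeries.

Definition isomorphic (F : fieldType) (A B : vectType F)
    (mulA : {bilinear A -> A -> A}) (mulB : {bilinear B -> B -> B}) : Prop :=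
  exists f : {linear A -> B},
    bijective f /\ forall x y, f (mulA x y) = mulB (f x) (f y).

Section Evolution.
Variables (F : fieldType) (n : nat).

(* The evolution algebra on F^n whose natural basis is the canonical basis and
   whose i-th basis vector has square sq`_i. *)
Definition evo_mul (sq : seq 'rV[F]_n) (x y : 'rV[F]_n) : 'rV[F]_n :=
  \sum_(i < n) (x 0 i * y 0 i) *: sq`_i.

Fact evo_mul_is_bilinear sq : bilinear_for *:%R *:%R (evo_mul sq).
Proof.
by split=> [y | x] k u v; rewrite /evo_mul /= scaler_sumr -big_split /=;
   apply: eq_bigr => i _; rewrite !mxE scalerA -scalerDl;
   rewrite ?mulrDl ?mulrDr ?mulrA // [_ * k]mulrC.
Qed.
HB.instance Definition _ sq :=
  bilinear_isBilinear.Build F 'rV[F]_n 'rV[F]_n 'rV[F]_n *:%R *:%R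
    (evo_mul sq) (evo_mul_is_bilinear sq).

Lemma evo_mul_delta sq (j k : 'I_n) :
  evo_mul sq (delta_mx 0 j) (delta_mx 0 k) = if j == k then sq`_j else 0.
Proof.
rewrite /evo_mul (bigD1 j) //= big1 ?addr0 => [|i /negPf ij].
  by rewrite !mxE !eqxx /= mul1r; case: eqVneq; rewrite ?scale1r ?scale0r.
by rewrite !mxE ij mul0r scale0r.
Qed.

Definition evo (sq : seq 'rV[F]_n) : {bilinear 'rV[F]_n -> 'rV[F]_n -> 'rV[F]_n} :=
  evo_mul sq.

Lemma evo_natural_basis sq :
  natural_basis (evo sq) [tuple delta_mx 0 i : 'rV[F]_n | i < n].
Proof.
split=> [|j k jk]; last by rewrite !tnth_mktuple [LHS]evo_mul_delta (negPf jk).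
rewrite basisEdim size_tuple dimvf /dim /= mul1n leqnn andbT.
apply/subvP=> x _; rewrite (row_sum_delta x).
apply: memv_suml => i _; rewrite memvZ // memv_span //.
by rewrite -(tnth_mktuple (fun k => delta_mx 0 k : 'rV[F]_n) i) mem_tnth.
Qed.

End Evolution.

Section Families.
Variable F : fieldType.

(* The basis vectors e_1, ..., e_5 of F^5, numbered from 1. *)
Definition e_ (k : nat) : 'rV[F]_5 := delta_mx 0 (inord k.-1).

Definition family1 := evo [:: e_ 2; e_ 3; e_ 4; e_ 5; 0].

Definition family2 := evo [:: e_ 2 + e_ 4; e_ 3; e_ 4; e_ 5; 0].

Definition family3 (a : F) :=
  evo [:: e_ 2 + e_ 3 + a *: e_ 4; e_ 3; e_ 4; e_ 5; 0].

Definition family4 (a b : F) :=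
  evo [:: e_ 2 + a *: e_ 3 + b *: e_ 4; e_ 3 + e_ 4; e_ 4; e_ 5; 0].

End Families.

Arguments family1 {F}.
Arguments family2 {F}.

(* Main.v *)
From HB Require Import structures.
Require Import Defs.
From mathcomp Require Import all_boot all_order all_algebra.
From mathcomp Require Import ring.

(* A natural basis vector exists at each level of the annihilator series.
   Rescaling such vectors and correcting them by annihilator elements, which
   changes no product, gives a natural basis u_0, ..., u_4 with
     u_0^2 = u_1 + a u_2 + b u_3,  u_1^2 = u_2 + c u_3,
     u_2^2 = u_3,  u_3^2 = u_4,  u_4^2 = 0.
   An isomorphism between two such algebras is triangular because it respects
   products, and then diagonal modulo the annihilator because the u_i are
   orthogonal; hence (a', b', c') = (a s^2, b s^6, c s^4) for some s <> 0.  The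
   families (1)-(4) are normal forms of the parameters under this action. *)

Set Implicit Arguments.
Unset Strict Implicit.
Unset Printing Implicit Defensive.

Import GRing.Theory.
Local Open Scope ring_scope.

(** * Isomorphisms onto [evo] algebras from orthogonal free families *)

Lemma isomorphic_trans (F : fieldType) (A B C : vectType F)
    (mulA : {bilinear A -> A -> A}) (mulB : {bilinear B -> B -> B})
    (mulC : {bilinear C -> C -> C}) :
  isomorphic mulA mulB -> isomorphic mulB mulC -> isomorphic mulA mulC.
Proof.
move=> [f [bij_f fM]] [g [bij_g gM]]; exists (g \o f); split=> [|x y /=].
  exact: bij_comp.
by rewrite fM gM.
Qed.

Section Basis.
Variables (F : fieldType) (E : vectType F) (mul : {bilinear E -> E -> E}).

Definition lin_comb n (u : 'I_n -> E) (x : 'rV[F]_n) : E :=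
  \sum_(i < n) x 0 i *: u i.

Fact lin_comb_is_linear n (u : 'I_n -> E) : linear (lin_comb u).
Proof.
move=> a x y; rewrite /lin_comb scaler_sumr -big_split /=.
by apply: eq_bigr => i _; rewrite !mxE scalerDl scalerA.
Qed.
HB.instance Definition _ n (u : 'I_n -> E) :=
  GRing.isLinear.Build F 'rV[F]_n E _ (lin_comb u) (lin_comb_is_linear u).

Lemma lin_comb_delta n (u : 'I_n -> E) i : lin_comb u (delta_mx 0 i) = u i.
Proof.
rewrite /lin_comb (bigD1 i) //= big1 ?addr0 ?mxE ?eqxx ?scale1r // => j.
by move=> /negPf ji; rewrite mxE ji scale0r.
Qed.

Lemma mul_lin_combl n (u : 'I_n -> E) x j :
  (forall i k : 'I_n, i != k -> mul (u i) (u k) = 0) ->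
  mul (lin_comb u x) (u j) = x 0 j *: mul (u j) (u j).
Proof.
move=> uO; rewrite /lin_comb linear_sumlz (bigD1 j) //= linearZl_LR.
by rewrite big1 ?addr0 // => i ij; rewrite linearZl_LR /= uO ?scaler0.
Qed.

(** The isomorphism is the inverse of [lin_comb u], which is injective by assumption and onto by
    dimension. It respects products because orthogonality leaves only the diagonal terms. *)
Lemma isomorphic_evo n (u : 'I_n -> E) (sq : seq 'rV[F]_n) :
  dim E = n -> (forall x, lin_comb u x = 0 -> x = 0) ->
  (forall i k : 'I_n, i != k -> mul (u i) (u k) = 0) ->
  (forall i : 'I_n, mul (u i) (u i) = lin_comb u sq`_i) ->
  isomorphic mul (evo sq).
Proof.
move=> dimE u_free uO uM; pose g := linfun (lin_comb u).
have gE x : g x = lin_comb u x by rewrite lfunE.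
have ker_g : lker g == 0%VS.
  apply/lker0P => x y; rewrite !gE => /eqP; rewrite -subr_eq0 -linearB => /eqP.
  by move/u_free/eqP; rewrite subr_eq0 => /eqP.
have im_g : limg g = fullv.
  apply/eqP; rewrite eqEdim subvf limg_dim_eq; last first.
    by rewrite (eqP ker_g) capv0.
  by rewrite !dimvf dimE /dim /= mul1n.
have gK : cancel g (g^-1)%VF by exact: lker0_lfunK.
have giK : cancel (g^-1)%VF g.
  by move=> x; apply: limg_lfunVK; rewrite im_g memvf.
exists (g^-1)%VF; split=> [|x y]; first by exists g.
rewrite -{1}(giK x) -{1}(giK y) /=.
move: (g^-1%VF x) (g^-1%VF y) => {}x {}y.
apply: (can_inj gK); rewrite giK !gE.
rewrite {2}/lin_comb linear_sumr -[evo _ _ _]/(\sum_(i < n) _) linear_sum /=.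
apply: eq_bigr => i _.
by rewrite linearZr_LR /= mul_lin_combl // uM !linearZ /= scalerA mulrC.
Qed.

End Basis.

(** * The three-parameter normal form and how to recognise it *)

Definition chain_sq (F : fieldType) (a b c : F) : seq 'rV[F]_5 :=
  [:: e_ F 2 + a *: e_ F 3 + b *: e_ F 4; e_ F 3 + c *: e_ F 4; e_ F 4; e_ F 5;
      0].

(** Families (1)-(4) are the points (0, 0, 0), (0, 1, 0), (1, a, 0) and (a, b, 1) of this parameter
    space. *)
Definition chain_alg (F : fieldType) (a b c : F) := evo (chain_sq a b c).

Lemma forall_ord5 (P : 'I_5 -> Prop) :
  P (inord 0) -> P (inord 1) -> P (inord 2) -> P (inord 3) -> P (inord 4) ->
  forall i, P i.
Proof.
move=> P0 P1 P2 P3 P4 i; rewrite -[i]inord_val.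
by case: i => [[|[|[|[|[|]]]]] ?].
Qed.

Section Chain.
Variables (F : fieldType) (E : vectType F) (mul : {bilinear E -> E -> E}).

(** Freeness of [u] follows from u_4 <> 0. Going back along the chain, u_0, ..., u_3 have nonzero
    squares: if u_1^2 = 0, multiplying by u_2 gives u_3 = 0, and if u_0^2 = 0, multiplying by u_1
    gives u_1^2 = 0. Multiplying a linear relation by u_j then kills its j-th coefficient for j < 4,
    and u_4 <> 0 kills the last. *)
Lemma isomorphic_chain (u : 'I_5 -> E) (a b c : F) :
  dim E = 5 -> (forall i k : 'I_5, i != k -> mul (u i) (u k) = 0) ->
  mul (u (inord 0)) (u (inord 0)) =
    u (inord 1) + a *: u (inord 2) + b *: u (inord 3) ->
  mul (u (inord 1)) (u (inord 1)) = u (inord 2) + c *: u (inord 3) ->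
  mul (u (inord 2)) (u (inord 2)) = u (inord 3) ->
  mul (u (inord 3)) (u (inord 3)) = u (inord 4) ->
  mul (u (inord 4)) (u (inord 4)) = 0 ->
  u (inord 4) != 0 ->
  isomorphic mul (chain_alg a b c).
Proof.
move=> dimE uO u0 u1 u2 u3 u4 nz4.
have O i k : (i < 5)%N -> (k < 5)%N -> i != k ->
    mul (u (inord i)) (u (inord k)) = 0.
  by move=> i5 k5 ik; rewrite uO // -val_eqE /= !inordK.
have nz3 : u (inord 3) != 0.
  by apply: contraNneq nz4 => z; rewrite -u3 z linear0l.
have nz1 : mul (u (inord 1)) (u (inord 1)) != 0.
  apply: contraNneq nz3 => /(congr1 (mul^~ (u (inord 2)))).
  by rewrite u1 linearDl linearZl_LR /= u2 O // scaler0 addr0 linear0l => ->.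
have nz0 : mul (u (inord 0)) (u (inord 0)) != 0.
  apply: contraNneq nz1 => /(congr1 (mul^~ (u (inord 1)))).
  rewrite u0 !linearDl !linearZl_LR /= (O 2 1)%N // (O 3 1)%N //.
  by rewrite !scaler0 !addr0 linear0l => ->.
apply: (isomorphic_evo dimE _ uO) => [x ux|]; last first.
  by apply: forall_ord5;
    rewrite !inordK ?u0 ?u1 ?u2 ?u3 ?u4 //= ?linearD ?linearZ ?linear0 /=
            ?lin_comb_delta.
have xj j : mul (u j) (u j) != 0 -> x 0 j = 0.
  move=> nzj; have := mul_lin_combl x j uO; rewrite ux linear0l => /esym/eqP.
  by rewrite scaler_eq0 (negPf nzj) orbF => /eqP.
have x0 := xj _ nz0; have x1 := xj _ nz1.
have x2 : x 0 (inord 2) = 0 by rewrite xj // u2.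
have x3 : x 0 (inord 3) = 0 by rewrite xj // u3.
apply/rowP; apply: forall_ord5; rewrite mxE //.
apply/eqP; rewrite -[_ == _]orbF -(negPf nz4) -scaler_eq0 -ux /lin_comb.
rewrite (bigD1 (inord 4)) //= big1 ?addr0 //.
by apply: forall_ord5; rewrite ?eqxx // ?x0 ?x1 ?x2 ?x3 scale0r.
Qed.

End Chain.

(** * Natural bases along the annihilator series *)

Section AnnihilatorSeries.
Variables (F : fieldType) (E : vectType F) (mul : {bilinear E -> E -> E}).

Local Notation S := (ann_series mul).

Lemma ann_series_leq j k : (j <= k)%N -> (S j <= S k)%VS.
Proof.
move=> /subnKC <-; elim: (k - j)%N => [|m IHm]; first by rewrite addn0.
rewrite addnS; apply: (subv_trans IHm); apply/subvP => x Sx.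
by apply/mem_ann_seriesS => y; apply: ann_series_ideal.
Qed.

Lemma mem_ann_series1 x y : x \in S 1 -> mul x y = 0 /\ mul y x = 0.
Proof.
by move=> /mem_ann_seriesS/(_ y) /=; rewrite !memv0 => -[/eqP-> /eqP->].
Qed.

Lemma ann_series_mul_basis n (e : n.-tuple E) x i :
  natural_basis mul e ->
  mul x (tnth e i) = coord e i x *: mul (tnth e i) (tnth e i) /\
  mul (tnth e i) x = coord e i x *: mul (tnth e i) (tnth e i).
Proof.
move=> [e_basis eO].
have xE := coord_basis e_basis (memvf x).
have eO' k : k != i -> mul e`_k (tnth e i) = 0 /\ mul (tnth e i) e`_k = 0.
  by move=> ki; rewrite -tnth_nth !eO // eq_sym.
split; rewrite {1}xE ?linear_sumlz ?linear_sumr (bigD1 i) //=.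
  rewrite linearZl_LR -tnth_nth big1 ?addr0 // => k /eO'[+ _].
  by rewrite linearZl_LR /= => ->; rewrite scaler0.
rewrite linearZr_LR -tnth_nth big1 ?addr0 // => k /eO'[_ +].
by rewrite linearZr_LR /= => ->; rewrite scaler0.
Qed.

Lemma basis_mem_ann_seriesS n (e : n.-tuple E) i j :
  natural_basis mul e ->
  tnth e i \in S j.+1 <-> mul (tnth e i) (tnth e i) \in S j.
Proof.
move=> eN; split=> [/mem_ann_seriesS/(_ (tnth e i))[] //|Si].
apply/mem_ann_seriesS => y.
by have [-> ->] := ann_series_mul_basis y i eN; rewrite memvZ.
Qed.

(** An [x] in [S j.+1] but not in [S j] has a nonzero coordinate at some basis vector outside [S j].
    Its product with that vector is a nonzero multiple of the vector's square and lies in [S j],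
    which puts the vector itself in [S j.+1]. *)
Lemma natural_basis_level n (e : n.-tuple E) j :
  natural_basis mul e -> (\dim (S j) < \dim (S j.+1))%N ->
  exists i, tnth e i \in S j.+1 /\ tnth e i \notin S j.
Proof.
move=> eN dimS; have [e_basis _] := eN.
have /subvPn[x Sx nSx] : ~~ (S j.+1 <= S j)%VS.
  by apply: contraL dimS => /dimvS; rewrite -leqNgt.
have [i xi nSi] : exists2 i, coord e i x != 0 & tnth e i \notin S j.
  apply/exists_inP; apply: contraNT nSx; rewrite negb_exists_in.
  move=> /forall_inP Se.
  rewrite (coord_basis e_basis (memvf x)); apply: memv_suml => i _.
  rewrite -tnth_nth; have [-> | xi] := eqVneq (coord e i x) 0.
    by rewrite scale0r mem0v.
  by rewrite memvZ //; have := Se i xi; rewrite negbK.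
exists i; split=> //; apply/(basis_mem_ann_seriesS _ _ eN).
have /mem_ann_seriesS/(_ (tnth e i))[+ _] := Sx.
by have [-> _] := ann_series_mul_basis x i eN; rewrite rpredZeq (negPf xi).
Qed.

(** Since [v] is outside [S j], adding the line through [v] raises the dimension by one and so fills
    [S j.+1]. *)
Lemma ann_series_decomp j v x :
  \dim (S j.+1) = (\dim (S j)).+1 -> v \in S j.+1 -> v \notin S j ->
  x \in S j.+1 -> exists c, x - c *: v \in S j.
Proof.
move=> dimS Sv nSv Sx.
have: (S j.+1 == S j + <[v]>)%VS.
  rewrite eq_sym eqEdim subv_add ann_series_leq // -memvE Sv dimS /=.
  rewrite dimv_disjoint_sum ?dim_vline; last first.
    apply/eqP; rewrite -subv0; apply/subvP => y; rewrite memv_cap memv0.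
    case/andP=> Sy /vlineP[c yE]; move: Sy.
    rewrite yE rpredZeq (negPf nSv) orbF; by move/eqP->; rewrite scale0r.
  by have [v0|] := eqVneq v 0; [rewrite v0 mem0v in nSv | rewrite addn1].
move/eqP => SE; move: Sx; rewrite SE => /memv_addP[y Sy [_ /vlineP[c ->] ->]].
by exists c; rewrite addrK.
Qed.

End AnnihilatorSeries.

(** * Reduction to the three-parameter normal form *)

Section Normalisation.
Variables (F : fieldType) (E : vectType F) (mul : {bilinear E -> E -> E}).

Local Notation S := (ann_series mul).

Lemma isomorphic_chain_alg :
  evolution_algebra mul -> has_type mul [:: 1; 1; 1; 1; 1]%N ->
  exists a b c, isomorphic mul (chain_alg a b c).
Proof.
move=> [n [e eN]] [S5 _ dimS0]; rewrite -[size _]/5%N in S5 dimS0.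
(* The type records truncated differences; monotonicity of the series makes them genuine ones. *)
have dimS j : (j < 5)%N -> \dim (S j.+1) = (\dim (S j)).+1.
  move=> j5; have d := dimS0 j j5; move: d.
  have -> : nth 0%N [:: 1; 1; 1; 1; 1]%N j = 1%N.
    by move: j5; do 5?case: j => [|j] //.
  move=> d; have := dimvS (ann_series_leq mul (leqnSn j)).
  by move/subnK; rewrite -d add1n.
have dimE : dim E = 5.
  by rewrite -dimvf -S5 !dimS // dimv0.
(* The numbering is reversed so that [b 0] is at the top level and [b 4] in the annihilator, and
   squaring moves from [b j] towards [b j.+1]. *)
have /fin_all_exists[i iP] (j : 'I_5) : exists i : 'I_n,
    tnth e i \in S (4 - j).+1 /\ tnth e i \notin S (4 - j).
  by apply: (natural_basis_level eN); rewrite dimS // ltnS leq_subr.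
have i_neq (j k : 'I_5) : (j < k)%N -> i j != i k.
  move=> ltjk; apply/eqP => ijk; have [_] := iP j; have [+ _] := iP k.
  rewrite ijk => Sk /negP; apply; move: Sk; apply/subvP/ann_series_leq.
  by rewrite ltn_sub2l // (leq_trans ltjk) // -ltnS.
pose b (j : nat) := tnth e (i (inord j)).
have b_sqr j k : b j \in S k.+1 <-> mul (b j) (b j) \in S k.
  exact: basis_mem_ann_seriesS.
have S_decomp j v x : (j < 5)%N -> v \in S j.+1 -> v \notin S j ->
    x \in S j.+1 -> exists c, x - c *: v \in S j.
  by move=> /dimS; apply: ann_series_decomp.
have S_leq := @ann_series_leq _ _ mul.
have S1 := @mem_ann_series1 _ _ mul.
have S_sqr j x : x \in S j.+1 -> mul x x \in S j.
  by move=> /mem_ann_seriesS/(_ x)[].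
have bO (j k : 'I_5) : j != k -> mul (b j) (b k) = 0.
  have [_ eO] := eN; rewrite /b !inord_val -val_eqE neq_ltn => /orP[] /i_neq ik.
    exact: eO.
  by apply: eO; rewrite eq_sym.
have bS j k : (j + k = 4)%N -> b j \in S k.+1 /\ b j \notin S k.
  move=> jk; have := iP (inord j).
  have jk' : (4 - j = k)%N by rewrite -jk addKn.
  by rewrite (inordK (_ : (j < 5)%N)) ?jk' // ltnS -jk leq_addr.
have b2S j k : (j + k = 4)%N -> mul (b j) (b j) \in S k.
  by move=> /bS[bj _]; apply/b_sqr.
have nb2S j k : (j + k = 3)%N -> mul (b j) (b j) \notin S k.
  move=> jk; have [|_ +] := bS j k.+1; first by rewrite addnS jk.
  by apply: contra => bj; apply/b_sqr.
(* Conversion must not compute with the fixpoint ann_series. *)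
set W := ann_series mul in S5 dimS0 dimS iP bS b2S nb2S b_sqr S_decomp S_leq
  S1 S_sqr *.
clearbody W.
(* The coefficient [p] is nonzero because the square of [b j] is not in level [k]: otherwise [b j]
   would drop to level [k.+1]. *)
have step j k : (j + k = 3)%N ->
    exists2 p, p != 0 & mul (b j) (b j) - p *: b j.+1 \in W k.
  move=> jk; have [|bj nbj] := bS j.+1 k; first by rewrite addSn jk.
  have [||p pP] := S_decomp _ _ (mul (b j) (b j)) _ bj nbj.
  - by rewrite -(leq_add2l j) addnS jk -addSnnS leq_addl.
  - by apply: b2S; rewrite addnS jk.
  exists p => //; apply: contraNneq (nb2S j k jk) => p0.
  by move: pP; rewrite p0 scale0r subr0.
have [p0 nz0 p0P] := step 0%N 3%N erefl.
have [p1 nz1 p1P] := step 1%N 2%N erefl.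
have [p2 nz2 p2P] := step 2%N 1%N erefl.
have [b21 b22] := (b2S 1%N 3%N erefl, b2S 2%N 2%N erefl).
have [nb21 nb22 nb23] :=
  And3 (nb2S 1%N 2%N erefl) (nb2S 2%N 1%N erefl) (nb2S 3%N 0%N erefl).
(* These are the leading coefficients forced by u_1 = p0 b_1 modulo the annihilator, then u_2 = s2
   b_2 and u_3 = s3 b_3. Since squares ignore annihilator terms, u_1^2 and u_2^2 are known in
   advance, so [u3] can be defined first, then [u2] and [u1]. *)
pose s2 := p0 ^+ 2 * p1; pose s3 := s2 ^+ 2 * p2.
have nzs2 : s2 != 0 by rewrite mulf_neq0 // expf_neq0.
have nzs3 : s3 != 0 by rewrite mulf_neq0 // expf_neq0.
pose u3 := s2 ^+ 2 *: mul (b 2%N) (b 2%N).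
have u3S : u3 \in W 2%N by rewrite memvZ.
have nu3S : u3 \notin W 1%N.
  by rewrite rpredZeq negb_or expf_neq0 //= nb22.
have [|c cP] :=
  S_decomp 1%N _ (p0 ^+ 2 *: mul (b 1%N) (b 1%N) - s2 *: b 2%N) isT u3S nu3S.
  by rewrite /s2 -scalerA -scalerBr memvZ.
pose u2 := p0 ^+ 2 *: mul (b 1%N) (b 1%N) - c *: u3.
have u2S : u2 \in W 3%N.
  by rewrite rpredB ?memvZ // (subvP (S_leq _ _ (leqnSn 2))).
have nu2S : u2 \notin W 2%N.
  by rewrite (rpredBr _ (memvZ c u3S)) rpredZeq negb_or expf_neq0 //= nb21.
have [a aP] := S_decomp 2%N _ _ isT u2S nu2S p0P.
have [d dP] := S_decomp 1%N _ _ isT u3S nu3S aP.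
pose u1 := mul (b 0%N) (b 0%N) - a *: u2 - d *: u3.
(* The aim is u_j = s_j b_j modulo [W 1], the annihilator, so that products of the u_j are rescaled
   products of the b_j. The last entry of [s] is 0 because u_3^2 already lies in [W 1]. *)
pose u (j : 'I_5) := nth 0 [:: b 0%N; u1; u2; u3; mul u3 u3] j.
pose s (j : 'I_5) := nth 0 [:: 1; p0; s2; s3; 0] j.
have uS j : u j - s j *: b j \in W 1%N.
  move: j; apply: forall_ord5; rewrite /u /s !inordK //=.
  - by rewrite scale1r subrr mem0v.
  - by rewrite addrAC [_ - a *: u2 - _]addrAC.
  - by rewrite addrAC.
  - by rewrite /u3 /s3 -scalerA -scalerBr memvZ.
  - by rewrite scale0r subr0; exact: S_sqr.
have uM j k : mul (u j) (u k) = (s j * s k) *: mul (b j) (b k).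
  rewrite -[u j](subrK (s j *: b j)) -[u k](subrK (s k *: b k)).
  rewrite linearDl /= (S1 _ _ (uS j)).1 linearDr /= (S1 _ _ (uS k)).2.
  by rewrite !add0r linearZl_LR linearZr_LR /= scalerA.
have uO (j k : 'I_5) : j != k -> mul (u j) (u k) = 0.
  by move=> jk; rewrite uM bO ?scaler0.
exists a, d, c; apply: (isomorphic_chain dimE uO); rewrite /u !inordK //=.
- by rewrite addrAC /u1 !subrK.
- have := uM (inord 1) (inord 1).
  by rewrite /u /s !inordK //= -expr2 => ->; rewrite subrK.
- by have := uM (inord 2) (inord 2); rewrite /u /s !inordK.
- exact: (S1 _ _ (S_sqr _ _ u3S)).1.
- have := uM (inord 3) (inord 3); rewrite /u /s !inordK //= => ->.
  rewrite scaler_eq0 mulf_eq0 negb_or (negPf nzs3) /=.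
  by apply: contraNneq nb23 => ->; rewrite mem0v.
Qed.

End Normalisation.

(** * Isomorphisms between normal forms *)

Section ChainIsomorphisms.
Variable F : fieldType.

Lemma evo_mulE n (sq : seq 'rV[F]_n) (x y : 'rV[F]_n) k :
  evo sq x y 0 k = \sum_(i < n) x 0 i * y 0 i * sq`_i 0 k.
Proof. by rewrite summxE; apply: eq_bigr => i _; rewrite mxE. Qed.

(** Each coordinate of a product involves only strictly earlier coordinates of the factors; this is
    the source of triangularity in [chain_params]. *)
Lemma chain_mulE (a b c : F) (x y : 'rV[F]_5) :
  let p i := x 0 (inord i) * y 0 (inord i) in
  let xy i := chain_alg a b c x y 0 (inord i) in
  [/\ xy 0%N = 0, xy 1%N = p 0%N, xy 2%N = a * p 0%N + p 1%N,
      xy 3%N = b * p 0%N + c * p 1%N + p 2%N & xy 4%N = p 3%N].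
Proof.
move=> p xy.
have xyE k : xy k = \sum_(i < 5) p i * (chain_sq a b c)`_i 0 (inord k).
  by rewrite /xy evo_mulE; apply: eq_bigr => i _; rewrite /p inord_val.
have eq5 i j : (i < 5)%N -> (j < 5)%N ->
    (inord i == inord j :> 'I_5) = (i == j).
  by move=> i5 j5; rewrite -val_eqE /= !inordK.
by split; rewrite xyE !big_ord_recl big_ord0 /= !mxE /= !eq5 //=; ring.
Qed.

(** Use the basis s^(2^i) e_i, with i counted from 0: squaring doubles the exponent, which preserves
    the leading terms and rescales the parameters. *)
Lemma chain_scale (a b c s : F) :
  s != 0 ->
  isomorphic (chain_alg (a * s ^+ 2) (b * s ^+ 6) (c * s ^+ 4))
    (chain_alg a b c).
Proof.
move=> nzs; set mul := chain_alg _ _ _.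
pose w (i : 'I_5) := nth 0 [:: s; s ^+ 2; s ^+ 4; s ^+ 8; s ^+ 16] i.
pose u (i : 'I_5) : 'rV[F]_5 := w i *: delta_mx 0 i.
have mulu i k : mul (u i) (u k) =
    if i == k
    then w i ^+ 2 *: (chain_sq (a * s ^+ 2) (b * s ^+ 6) (c * s ^+ 4))`_i
    else 0.
  rewrite linearZl_LR linearZr_LR /= [evo_mul _ _ _]evo_mul_delta.
  by case: eqVneq => [->|_]; rewrite ?scalerA ?scaler0.
apply: (isomorphic_chain (u := u)); first by rewrite /dim /=.
- by move=> i k /negPf ik; rewrite mulu ik.
- rewrite mulu eqxx /u /w !inordK //= /e_ !scalerDr !scalerA.
  by congr (_ + _ *: _ + _ *: _); ring.
- rewrite mulu eqxx /u /w !inordK //= /e_ !scalerDr !scalerA.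
  by congr (_ *: _ + _ *: _); ring.
- by rewrite mulu eqxx /u /w !inordK //= /e_ -exprM.
- by rewrite mulu eqxx /u /w !inordK //= /e_ -exprM.
- by rewrite mulu eqxx /u /w !inordK //= scaler0.
rewrite /u /w inordK //= scaler_eq0 expf_eq0 (negPf nzs) /=.
apply/eqP => /rowP/(_ (inord 4)); rewrite !mxE !eqxx => /eqP.
by rewrite oner_eq0.
Qed.

Lemma chain_params (a b c a' b' c' : F) :
  isomorphic (chain_alg a b c) (chain_alg a' b' c') ->
  exists s, [/\ s != 0, a' = a * s ^+ 2, b' = b * s ^+ 6 & c' = c * s ^+ 4].
Proof.
move=> [f [/bij_inj f_inj fM]].
pose v (i k : nat) : F := f (delta_mx 0 (inord i)) 0 (inord k).
pose vv i j (k : nat) : F := chain_alg a' b' c' (f (delta_mx 0 (inord i)))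
  (f (delta_mx 0 (inord j))) 0 (inord k).
have vvE i j k : (i < 5)%N -> (j < 5)%N ->
    vv i j k = if i == j then f (chain_sq a b c)`_i 0 (inord k) else 0.
  move=> i5 j5; rewrite /vv -fM [chain_alg _ _ _ _ _]evo_mul_delta.
  rewrite -val_eqE /= !inordK //; case: ifP => // _.
  by rewrite linear0 mxE.
have vvM i j := chain_mulE a' b' c' (f (delta_mx 0 (inord i)))
  (f (delta_mx 0 (inord j))).
have vv0 i j : vv i j 0%N = 0 by have [] := vvM i j.
have vv1 i j : vv i j 1%N = v i 0%N * v j 0%N.
  by have [] := vvM i j.
have vv2 i j : vv i j 2%N = a' * (v i 0%N * v j 0%N) + v i 1%N * v j 1%N.
  by have [] := vvM i j.
have vv3 i j : vv i j 3%N =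
    b' * (v i 0%N * v j 0%N) + c' * (v i 1%N * v j 1%N) + v i 2%N * v j 2%N.
  by have [] := vvM i j.
have vv4 i j : vv i j 4%N = v i 3%N * v j 3%N.
  by have [] := vvM i j.
have E0 k : v 1%N k + a * v 2%N k + b * v 3%N k = vv 0%N 0%N k.
  by rewrite vvE //= !linearD !linearZ /= !mxE.
have E1 k : v 2%N k + c * v 3%N k = vv 1%N 1%N k.
  by rewrite vvE //= !linearD !linearZ /= !mxE.
have E2 k : v 3%N k = vv 2%N 2%N k by rewrite vvE.
have E3 k : v 4%N k = vv 3%N 3%N k by rewrite vvE.
(* Comparing the image of each square with the square of the image, one coordinate after another,
   gives [v i k] = 0 for k < i and [v i i] = s^(2^i). *)
have v30 : v 3%N 0%N = 0 by rewrite E2 vv0.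
have v40 : v 4%N 0%N = 0 by rewrite E3 vv0.
have v20 : v 2%N 0%N = 0 by have := E1 0%N; rewrite vv0 v30 mulr0 addr0.
have v10 : v 1%N 0%N = 0 by have := E0 0%N; rewrite vv0 v20 v30 !mulr0 !addr0.
have v31 : v 3%N 1%N = 0 by rewrite E2 vv1 v20 mul0r.
have v41 : v 4%N 1%N = 0 by rewrite E3 vv1 v30 mul0r.
have v21 : v 2%N 1%N = 0 by have := E1 1%N; rewrite vv1 v10 v31 !mulr0 addr0.
pose s := v 0%N 0%N.
have v11 : v 1%N 1%N = s ^+ 2.
  by have := E0 1%N; rewrite vv1 v21 v31 !mulr0 !addr0.
have v32 : v 3%N 2%N = 0 by rewrite E2 vv2 v20 v21 !mulr0 addr0.
have v42 : v 4%N 2%N = 0 by rewrite E3 vv2 v30 v31 !mulr0 addr0.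
have v22 : v 2%N 2%N = s ^+ 4.
  by have := E1 2%N; rewrite vv2 v10 v11 v32 !mulr0 addr0 add0r -exprD.
have v33 : v 3%N 3%N = s ^+ 8.
  by rewrite E2 vv3 v20 v21 v22 !mulr0 !add0r -exprD.
have v43 : v 4%N 3%N = 0 by rewrite E3 vv3 v30 v31 v32 !mulr0 !addr0.
have v44 : v 4%N 4%N = s ^+ 16 by rewrite E3 vv4 v33 -exprD.
(* If s = 0, the whole image of the last basis vector vanishes, against injectivity. *)
have nzs : s != 0.
  apply/eqP => s0; have f0 : f (delta_mx 0 (inord 4)) = 0.
    apply/rowP; apply: forall_ord5; rewrite [RHS]mxE //.
    by rewrite [LHS]v44 s0 expr0n.
  have /f_inj/rowP/(_ (inord 4)) := etrans f0 (esym (linear0 f)).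
  by rewrite !mxE !eqxx => /eqP; rewrite oner_eq0.
have cancel_s x n : x * s ^+ n = 0 -> x = 0.
  by move=> /eqP; rewrite mulf_eq0 expf_eq0 (negPf nzs) andbF orbF => /eqP.
(* f(e_i) f(e_j) = 0 for i < j <= 3, read off in coordinate j + 1. *)
have v01 : v 0%N 1%N = 0.
  have := vvE 0%N 1%N 2%N isT isT; rewrite /= vv2 v10 v11 !mulr0 add0r.
  exact: cancel_s.
have v02 : v 0%N 2%N = 0.
  have := vvE 0%N 2%N 3%N isT isT; rewrite /= vv3 v20 v21 v22 !mulr0 !add0r.
  exact: cancel_s.
have v12 : v 1%N 2%N = 0.
  have := vvE 1%N 2%N 3%N isT isT; rewrite /= vv3 v20 v21 v22 !mulr0 !add0r.
  exact: cancel_s.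
have v13 : v 1%N 3%N = 0.
  have := vvE 1%N 3%N 4%N isT isT; rewrite /= vv4 v33; exact: cancel_s.
have v23 : v 2%N 3%N = 0.
  have := vvE 2%N 3%N 4%N isT isT; rewrite /= vv4 v33; exact: cancel_s.
have nzs' n : s ^+ n != 0 by rewrite expf_neq0.
have sub := (v01, v02, v12, v13, v23, v22, v32, v33, v10, v11).
exists s; split=> //.
(* With the off-diagonal entries gone, the relations become a s^4 = a' s^2, b s^8 = b' s^2 and c s^8
   = c' s^4. *)
- apply: (mulIf (nzs' 2)); have := E0 2%N.
  by rewrite vv2 !sub -/s !mulr0 !addr0 add0r => <-; ring.
- apply: (mulIf (nzs' 2)); have := E0 3%N.
  by rewrite vv3 !sub -/s !mulr0 !addr0 !add0r => <-; ring.
- apply: (mulIf (nzs' 4)); have := E1 3%N.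
  rewrite vv3 !sub !mulr0 !add0r addr0 -exprD => <-; ring.
Qed.

End ChainIsomorphisms.

(** * Roots and the classification *)

Lemma closed_field_root (F : closedFieldType) n (c : F) :
  (0 < n)%N -> exists s, s ^+ n = c.
Proof.
move=> n_gt0.
(* The lower-order coefficients are [c] in degree 0 and zero elsewhere, so the equation solved is
   s^n = c. *)
have [s sE] := @solve_monicpoly F n (fun i => c *+ (i == 0)%N) n_gt0.
exists s; rewrite sE -(prednK n_gt0) big_ord_recl big1 => [|i _].
  by rewrite expr0 mulr1 addr0.
by rewrite mul0r.
Qed.

Theorem theorem6p8 (F : closedFieldType) (charF : 2%N \notin [pchar F]) :
  (forall (E : vectType F) (mul : {bilinear E -> E -> E}),
      evolution_algebra mul -> nilpotent_algebra mul ->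
      has_type mul [:: 1; 1; 1; 1; 1]%N ->
      [\/ isomorphic mul family1,
          isomorphic mul family2,
          exists a : F, isomorphic mul (family3 a)
        | exists a b : F, isomorphic mul (family4 a b)])
  /\ ~ isomorphic (@family1 F) family2
  /\ (forall a : F, ~ isomorphic family1 (family3 a))
  /\ (forall a b : F, ~ isomorphic family1 (family4 a b))
  /\ (forall a : F, ~ isomorphic family2 (family3 a))
  /\ (forall a b : F, ~ isomorphic family2 (family4 a b))
  /\ (forall a a' b' : F, ~ isomorphic (family3 a) (family4 a' b'))
  /\ (forall a a' : F, a <> a' -> ~ isomorphic (family3 a) (family3 a'))
  /\ (forall a b a' b' : F,
        isomorphic (family4 a b) (family4 a' b') <->
        (a', b') = (a, b) \/ (a', b') = (- a, - b)).
Proof.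
have f1E : family1 = chain_alg 0 0 0 :> {bilinear _ -> _ -> 'rV[F]_5}.
  by rewrite /chain_alg /chain_sq !scale0r !addr0.
have f2E : family2 = chain_alg 0 1 0 :> {bilinear _ -> _ -> 'rV[F]_5}.
  by rewrite /chain_alg /chain_sq !scale0r scale1r !addr0.
have f3E (a : F) : family3 a = chain_alg 1 a 0.
  by rewrite /chain_alg /chain_sq !scale0r scale1r !addr0.
have f4E (a b : F) : family4 a b = chain_alg a b 1.
  by rewrite /chain_alg /chain_sq scale1r.
have root_neq0 n (c : F) : (0 < n)%N -> c != 0 ->
    exists2 s : F, s != 0 & c = s ^+ n.
  move=> n_gt0 nzc; have [s sE] := closed_field_root c n_gt0; exists s => //.
  by apply: contraNneq nzc => s0; rewrite -sE s0 expr0n gtn_eqF.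
rewrite f1E f2E; split=> [E mul evoE _ typeE|].
  have [a [b [c iso]]] := isomorphic_chain_alg evoE typeE.
  have rescale s a0 b0 c0 : s != 0 ->
      a = a0 * s ^+ 2 -> b = b0 * s ^+ 6 -> c = c0 * s ^+ 4 ->
      isomorphic mul (chain_alg a0 b0 c0).
    move=> nzs aE bE cE; apply: isomorphic_trans iso _.
    by rewrite aE bE cE; apply: chain_scale.
  (* The first nonzero parameter in the order c, a, b is scaled to 1 by a fourth, square or sixth
     root, giving family (4), (3) or (2); if all vanish, family (1). *)
  have [c0 | nzc] := eqVneq c 0; last first.
    have [//|s nzs cE] := root_neq0 4 c _ nzc.
    apply: Or44; exists (a / s ^+ 2), (b / s ^+ 6); rewrite f4E.
    by apply: (rescale s); rewrite ?divfK ?expf_neq0 ?mul1r.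
  have [a0 | nza] := eqVneq a 0; last first.
    have [//|s nzs aE] := root_neq0 2 a _ nza.
    apply: Or43; exists (b / s ^+ 6); rewrite f3E.
    by apply: (rescale s); rewrite ?divfK ?expf_neq0 ?mul1r ?mul0r.
  have [b0 | nzb] := eqVneq b 0.
    by apply: Or41; rewrite a0 b0 c0 in iso.
  have [//|s nzs bE] := root_neq0 6 b _ nzb.
  by apply: Or42; apply: (rescale s); rewrite ?mul1r ?mul0r.
have nz1 : (1 : F) != 0 := oner_neq0 F.
have neq10 : 1 <> 0 :> F by apply/eqP.
(* Each pair of families is separated by a parameter that is 0 in the first and 1 in the second,
   since scaling keeps 0. *)
split; first by move=> /chain_params[s [_ _]]; rewrite mul0r.
split; first by move=> a; rewrite f3E => /chain_params[s [_]]; rewrite mul0r.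
split.
  by move=> a b; rewrite f4E => /chain_params[s [_ _ _]]; rewrite mul0r.
split; first by move=> a; rewrite f3E => /chain_params[s [_]]; rewrite mul0r.
split.
  by move=> a b; rewrite f4E => /chain_params[s [_ _ _]]; rewrite mul0r.
split.
  by move=> a a' b'; rewrite f3E f4E => /chain_params[s [_ _ _]]; rewrite mul0r.
split=> [a a' neq_a | a b a' b'].
  rewrite !f3E => /chain_params[s [_]]; rewrite mul1r => s2 aE _; apply: neq_a.
  (* The parameter fixed to 1 forces s^2 = 1, hence s^6 = 1. *)
  by rewrite aE -[6%N]/(2 * 3)%N exprM -s2 expr1n mulr1.
rewrite !f4E; split.
  move=> /chain_params[s [_ aE bE]]; rewrite mul1r => s4.
  (* Here s^4 = 1, so both a and b are multiplied by s^2 = s^6, a sign. *)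
  have: s ^+ 2 == 1 \/ s ^+ 2 == - 1.
    by apply/orP; rewrite -sqrf_eq1 -exprM -s4.
  rewrite aE bE -[6%N]/(4 + 2)%N exprD -s4 mul1r.
  by case=> /eqP->; [left | right]; rewrite ?mulr1 ?mulrN1.
(* Scaling by a square root of -1 realises the sign change: its fourth power is 1, its square and
   sixth power are -1. *)
have [i iE] := closed_field_root (-1 : F) (isT : 0 < 2)%N.
have i4 : i ^+ 4 = 1 by rewrite -[4%N]/(2 * 2)%N exprM iE sqrrN expr1n.
have i6 : i ^+ 6 = -1 by rewrite -[6%N]/(4 + 2)%N exprD i4 iE mul1r.
have nzi : i != 0.
  by apply: contraNneq nz1 => i0; rewrite -i4 i0 expr0n.
case=> -[-> ->].
  have := chain_scale a b 1 nz1; by rewrite !expr1n !mulr1.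
by have := chain_scale (- a) (- b) 1 nzi; rewrite iE i4 i6 !mulrN1 !opprK mulr1.
Qed.
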